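(* Let $f_1,\dots,f_n\in\mathbf R[x]$, $x=(x_1,\dots,x_n)$, and $\delta_f=\sum_{i=1}^n(\deg(f_i)-1)$. Let $\varepsilon\ge 0$ be an integer and let $E'$ be a functional on $\mathbf R[x]$ that annuls $(f)_x^{\le\delta_f+\varepsilon}$ and satisfies $E'*1-1\in(f)_x$. Then: 1) If $F\in\mathbf R[x^{\le d}]$, then $E'*F\in\mathbf R[x^{\le\max(\delta_f,\,d-\varepsilon-1)}]$ and $F-E'*F\in(f)_x\cap\mathbf R[x^{\le\max(\delta_f,d)}]$. 2) If a functional $l$ annuls $(f)_x$, then $l=E'*l=l*E'$. 3) If a functional $l$ annuls $(f)_x$ and $L'$ is a functional with $L'=l$ in $\mathbf R[x^{\le\delta_f+\delta}]$, where $\delta\ge0$, then $l=E'*L'=L'*E'$ in $\mathbf R[x^{\le\delta_f+\delta+\varepsilon+1}]$. 4) If a functional $L$ annuls $(f)_x\cap\mathbf R[x^{\le\delta_f+\delta}]$, where $\delta\ge0$, then $L=E'*L=L*E'$ in $\mathbf R[x^{\le\delta_f+\delta}]$, and $E'*L=L*E'$ annuls $(f)_x\cap\mathbf R[x^{\le\delta_f+\delta+\varepsilon+1}]$ (the equality $E'*L=L*E'$ here being understood in $\mathbf R[x^{\le\delta_f+\delta+\varepsilon+1}]$).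
   Context: $\mathbf R$ is a commutative ring with unity, $x=(x_1,\dots,x_n)$ are variables and $y=(y_1,\dots,y_n)$ is a second copy of them. $\deg$ is total degree; the $f_i$ are nonzero so that $\deg f_i$ is an integer. $\mathbf R[x^{\le d}]$ is the set of polynomials in $\mathbf R[x]$ of total degree $\le d$ (it is $\{0\}$ if $d<0$). $(f)_x$ is the ideal of $\mathbf R[x]$ generated by $f_1,\dots,f_n$. $(f)_x^{\le d}$ is the set of all $\sum_i f_i g_i$ with $g_i\in\mathbf R[x^{\le d-\deg f_i}]$. A functional is an $\mathbf R$-linear map $L:\mathbf R[x]\to\mathbf R$, with value on $F$ written $L.F$. It annuls a set $S$ if $L.s=0$ for all $s\in S$. Two functionals are equal in a subspace $V$ if they agree on all elements of $V$. $L(y_* )$ denotes the functional $L$ acting on the variables $y$; it is applied to a polynomial in $(x,y)$ by $\mathbf R[x]$-linear extension and gives an element of $\mathbf R[x]$. Difference derivatives: $\nabla F(x,y)$ is a column $(\nabla^1F,\dots,\nabla^nF)^T$ of polynomials in $\mathbf R[x,y]$ of total degree $\le\deg F-1$ in $(x,y)$ (zero if $F$ is constant) with $F(x)-F(y)=\sum_k(x_k-y_k)\nabla^kF(x,y)$. Fix any choice of $\nabla f_i$ for each $i$, and let $\nabla f(x,y)$ be the $n\times n$ matrix with columns $\nabla f_1,\dots,\nabla f_n$. Also fix an $\mathbf R$-linear operator $\nabla_x(x,y):F\mapsto\nabla F(x,y)$ giving such columns for all $F\in\mathbf R[x]$. Extension operation: for a functional $L$ and $F\in\mathbf R[x]$,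 $$L*F=[L].F=L(y_* ).\det\begin{pmatrix}\nabla f(x,y)&\nabla F(x,y)\\ f(x)&F(x)\end{pmatrix}=L(y_* ).\det\begin{pmatrix}\nabla f(x,y)&\nabla F(x,y)\\ f(y)&F(y)\end{pmatrix}\in\mathbf R[x],$$ where $f(x)$ is the row $(f_1(x),\dots,f_n(x))$; thus $[L]$ is an $\mathbf R$-linear operator on $\mathbf R[x]$. For functionals $l,L$, the functional $l*L$ is defined by $(l*L).F=l.(L*F)$. All degree bounds $d,\delta,\varepsilon$ are integers. *)

(* Defs.v *)
From HB Require Import structures.
From mathcomp Require Import all_boot all_order all_algebra.
From mathcomp Require Import ssrcomplements mpoly.

Set Implicit Arguments.
Unset Strict Implicit.
Unset Printing Implicit Defensive.

Import Order.TTheory GRing.Theory Num.Theory.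
Local Open Scope ring_scope.

Section Degree.
Variables (R : comNzRingType) (m : nat).

(* Total degree, with the convention deg 0 = -1. *)
Definition tdeg (p : {mpoly R[m]}) : int := (msize p)%:Z - 1.

(* Membership in R[x^{<=d}]; for d < 0 only the zero polynomial qualifies. *)
Definition deg_le (d : int) (p : {mpoly R[m]}) : Prop :=
  forall u, u \in msupp p -> (mdeg u)%:Z <= d.

Lemma deg_le_tdeg (d : int) (p : {mpoly R[m]}) :
  deg_le d p <-> p = 0 \/ tdeg p <= d.
Proof.
have [->|p0] := eqVneq p 0.
  by split=> _; [left | move=> u; rewrite msupp0].
have mE : (mdeg (mlead p)).+1 = msize p by apply: mlead_deg.
have tE : tdeg p = (mdeg (mlead p))%:Z by rewrite /tdeg -mE -natz mulrSr addrK natz.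
split=> [h|[/eqP|h]]; first by right; rewrite tE; apply: h; apply: mlead_supp.
  by rewrite (negPf p0).
move=> u /msize_mdeg_lt; rewrite -mE ltnS => hu.
by apply: le_trans h; rewrite tE lez_nat.
Qed.

End Degree.

Section Functionals.
Variables (R : comNzRingType) (n : nat).
Implicit Types (V : {mpoly R[n]} -> Prop) (L : {mpoly R[n]} -> R).

Definition annuls L V : Prop := forall s, V s -> L s = 0.

Definition eq_in V L1 L2 : Prop := forall F, V F -> L1 F = L2 F.

End Functionals.

Section Ideal.
Variables (R : comNzRingType) (n : nat) (f : 'I_n -> {mpoly R[n]}).

Definition in_ideal (p : {mpoly R[n]}) : Prop :=
  exists g : 'I_n -> {mpoly R[n]}, p = \sum_i f i * g i.

(* In general strictly smaller than the intersection of in_ideal with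
   deg_le d: the degree of each summand is bounded, not that of the sum. *)
Definition in_ideal_le (d : int) (p : {mpoly R[n]}) : Prop :=
  exists2 g : 'I_n -> {mpoly R[n]},
    forall i, deg_le (d - tdeg (f i)) (g i) & p = \sum_i f i * g i.

Definition delta : int := \sum_i (tdeg (f i) - 1).

End Ideal.

Section TwoCopies.
(* R[x, y] is {mpoly R[n + n]}: the first n variables are the x_k, the last n
   are the y_k, so that msize and deg_le measure the total degree in (x, y). *)
Variables (R : comNzRingType) (n : nat).

Definition Xvar (k : 'I_n) : {mpoly R[n + n]} := 'X_(lshift n k).
Definition Yvar (k : 'I_n) : {mpoly R[n + n]} := 'X_(rshift n k).

Definition in_x (F : {mpoly R[n]}) : {mpoly R[n + n]} :=
  F \mPo [tuple Xvar k | k < n].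
Definition in_y (F : {mpoly R[n]}) : {mpoly R[n + n]} :=
  F \mPo [tuple Yvar k | k < n].

Definition mnm_x (u : 'X_{1..n + n}) : 'X_{1..n} :=
  [multinom u (lshift n k) | k < n].
Definition mnm_y (u : 'X_{1..n + n}) : 'X_{1..n} :=
  [multinom u (rshift n k) | k < n].

(* L(y_* ).G : the R[x]-linear extension of L, sending x^a y^b to L(x^b) x^a. *)
Definition apply_y (L : {mpoly R[n]} -> R) (G : {mpoly R[n + n]}) :
    {mpoly R[n]} :=
  \sum_(u <- msupp G) (G@_u * L 'X_[mnm_y u]) *: 'X_[mnm_x u].

Lemma apply_yE (L : {mpoly R[n]} -> R) (G : {mpoly R[n + n]}) (i : nat) :
  (msize G <= i)%N ->
  apply_y L G =
  \sum_(u : 'X_{1..(n + n) < i}) (G@_u * L 'X_[mnm_y u]) *: 'X_[mnm_x u].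
Proof.
move=> le_Gi; set I : subFinType _ := 'X_{1..(n + n) < i}.
rewrite /apply_y (big_mksub I) ?msupp_uniq //=; first last.
  by move=> u /msize_mdeg_lt /leq_trans; apply.
rewrite big_rmcond //= => u /memN_msupp_eq0 ->.
by rewrite mul0r scale0r.
Qed.

Fact apply_y_is_linear (L : {mpoly R[n]} -> R) : linear (apply_y L).
Proof.
move=> a p q.
pose i := maxn (msize (a *: p + q)) (maxn (msize p) (msize q)).
rewrite !(@apply_yE _ _ i) ?leq_max ?leqnn ?orbT //.
rewrite scaler_sumr -big_split; apply: eq_bigr => u _ /=.
by rewrite mcoeffD mcoeffZ mulrDl scalerDl -mulrA scalerA.
Qed.

HB.instance Definition _ (L : {mpoly R[n]} -> R) :=
  GRing.isLinear.Build R {mpoly R[n + n]} {mpoly R[n]} _ (apply_y L)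
    (apply_y_is_linear L).

Lemma in_xX (u : 'X_{1..n}) :
  in_x 'X_[u] = 'X_[[multinom (match split i with inl k => u k | inr _ => 0%N end)
                    | i < n + n]].
Proof.
rewrite /in_x comp_mpolyX [RHS]mpolyXE_id big_split_ord /= [X in _ = _ * X]big1.
  rewrite mulr1; apply: eq_bigr => k _; rewrite tnth_mktuple mnmE.
  by rewrite -[lshift _ _]/(unsplit (inl _)) unsplitK.
move=> k _; rewrite mnmE.
by rewrite -[rshift _ _]/(unsplit (inr _)) unsplitK expr0.
Qed.

Lemma in_yX (u : 'X_{1..n}) :
  in_y 'X_[u] = 'X_[[multinom (match split i with inl _ => 0%N | inr k => u k end)
                    | i < n + n]].
Proof.
rewrite /in_y comp_mpolyX [RHS]mpolyXE_id big_split_ord /= [X in _ = X * _]big1.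
  rewrite mul1r; apply: eq_bigr => k _; rewrite tnth_mktuple mnmE.
  by rewrite -[rshift _ _]/(unsplit (inr _)) unsplitK.
move=> k _; rewrite mnmE.
by rewrite -[lshift _ _]/(unsplit (inl _)) unsplitK expr0.
Qed.

(* With additivity, this characterizes apply_y L as the R[x]-linear
   extension of L. *)
Lemma apply_y_mul (L : {scalar {mpoly R[n]}}) (A B : {mpoly R[n]}) :
  apply_y L (in_x A * in_y B) = L B *: A.
Proof.
have XX (u v : 'X_{1..n}) :
    apply_y L (in_x 'X_[u] * in_y 'X_[v]) = L 'X_[v] *: 'X_[u].
  rewrite in_xX in_yX -mpolyXD /apply_y msuppX big_seq1 mcoeffX eqxx mul1r.
  congr (L 'X_[_] *: 'X_[_]); apply/mnmP => k; rewrite !mnmE.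
    by rewrite -[rshift _ _]/(unsplit (inr _)) unsplitK.
  by rewrite -[lshift _ _]/(unsplit (inl _)) unsplitK addn0.
rewrite [in LHS](mpolyE A) [in LHS](mpolyE B) /in_x /in_y !raddf_sum /=.
rewrite big_distrlr raddf_sum [in RHS](mpolyE A) scaler_sumr.
apply: eq_bigr => u _ /=; rewrite raddf_sum [in RHS](mpolyE B) raddf_sum.
rewrite scaler_suml; apply: eq_bigr => v _ /=.
rewrite !comp_mpolyZ -scalerAl -scalerAr scalerA -/(in_x _) -/(in_y _).
rewrite linearZ /= XX linearZ /= !scalerA; congr (_ *: _).
by rewrite linearZ /= mulrAC mulrC [_ * A@_u]mulrC.
Qed.

(* For constant F the bound is -1 (-2 for F = 0), which forces D = 0. *)
Definition diff_derivative (F : {mpoly R[n]})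
    (D : 'cV[{mpoly R[n + n]}]_n) : Prop :=
  (forall k, deg_le (tdeg F - 1) (D k 0)) /\
  in_x F - in_y F = \sum_k (Xvar k - Yvar k) * D k 0.

End TwoCopies.

Section Extension.
Variables (R : comNzRingType) (n : nat) (f : 'I_n -> {mpoly R[n]}).
(* Df is the matrix whose i-th column is the chosen difference derivative of
   f i; it need not agree with nabla applied to f i. *)
Variable Df : 'M[{mpoly R[n + n]}]_n.
(* An R-linear operator into columns is given by its R-linear components. *)
Variable nabla : 'I_n -> {linear {mpoly R[n]} -> {mpoly R[n + n]}}.

Definition nabla_col (F : {mpoly R[n]}) : 'cV[{mpoly R[n + n]}]_n :=
  \col_k nabla k F.

Definition extension_matrix (F : {mpoly R[n]}) : 'M[{mpoly R[n + n]}]_(n + 1) :=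
  block_mx Df (nabla_col F) (\row_i in_x (f i)) (in_x F)%:M.

(* L * F = [L].F *)
Definition extend (L : {scalar {mpoly R[n]}}) (F : {mpoly R[n]}) :
    {mpoly R[n]} :=
  apply_y L (\det (extension_matrix F)).

(* The last row (f(x), F(x)) may be replaced by (f(y), F(y)). *)
Lemma det_extension_matrix_y (F : {mpoly R[n]}) :
    (forall i, diff_derivative (f i) (col i Df)) ->
    diff_derivative F (nabla_col F) ->
  \det (extension_matrix F) =
  \det (block_mx Df (nabla_col F) (\row_i in_y (f i)) (in_y F)%:M).
Proof.
move=> hf [_ hF]; pose v : 'rV[{mpoly R[n + n]}]_n := \row_k (Xvar R k - Yvar R k).
have -> : block_mx Df (nabla_col F) (\row_i in_y (f i)) (in_y F)%:M =
    block_mx 1%:M 0 (- v) 1%:M *m extension_matrix F.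
  rewrite mulmx_block !mul1mx !mul0mx !addr0; congr block_mx.
    apply/rowP => i; have [_ hi] := hf i; rewrite mulNmx !mxE addrC.
    rewrite -[LHS](subKr (in_x (f i))) hi; congr (_ - _).
    by apply: eq_bigr => k _; rewrite !mxE.
  apply/matrixP => i j; rewrite !ord1 mulNmx !mxE !eqxx !mulr1n addrC.
  rewrite -[LHS](subKr (in_x F)) hF; congr (_ - _).
  by apply: eq_bigr => k _; rewrite !mxE.
by rewrite det_mulmx det_lblock !det1 !mul1r.
Qed.

Lemma det_last_col_linear (a : R) (M A B : 'M[{mpoly R[n + n]}]_(n + 1)) :
    (forall i (k : 'I_n), A i (lshift 1 k) = M i (lshift 1 k)) ->
    (forall i (k : 'I_n), B i (lshift 1 k) = M i (lshift 1 k)) ->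
    (forall i (k : 'I_1), M i (rshift n k) =
                          a *: A i (rshift n k) + B i (rshift n k)) ->
  \det M = a *: \det A + \det B.
Proof.
move=> hA hB hM; pose j : 'I_(n + 1) := rshift n ord0.
have cof (C : 'M_(n + 1)) : (forall i k, C i (lshift 1 k) = M i (lshift 1 k)) ->
    forall i, cofactor C i j = cofactor M i j.
  move=> hC i; rewrite /cofactor.
  suff -> : col' j C = col' j M by [].
  apply/matrixP => k l; rewrite mxE [RHS]mxE.
  case: (split_ordP (lift j l)) => [l' ->|l' hl]; first by rewrite hC.
  by move: (neq_lift j l); rewrite hl ord1 eqxx.
rewrite !(expand_det_col _ j) scaler_sumr -big_split; apply: eq_bigr => i _ /=.
by rewrite hM (cof A hA) (cof B hB) mulrDl scalerAl.
Qed.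

Fact extend_is_linear (L : {scalar {mpoly R[n]}}) : linear (extend L).
Proof.
move=> a F G; rewrite /extend -linearP; congr (apply_y L _).
apply: det_last_col_linear => i k; rewrite /extension_matrix.
- by case: (split_ordP i) => i' ->;
    [rewrite [LHS]block_mxEul [RHS]block_mxEul
    |rewrite [LHS]block_mxEdl [RHS]block_mxEdl].
- by case: (split_ordP i) => i' ->;
    [rewrite [LHS]block_mxEul [RHS]block_mxEul
    |rewrite [LHS]block_mxEdl [RHS]block_mxEdl].
rewrite (ord1 k); case: (split_ordP i) => i' ->.
  rewrite [LHS]block_mxEur [X in _ = _ *: X + _]block_mxEur.
  by rewrite [X in _ = _ + X]block_mxEur [LHS]mxE [X in _ = _ *: X + _]mxE
    [X in _ = _ + X]mxE linearP.
rewrite [LHS]block_mxEdr [X in _ = _ *: X + _]block_mxEdr.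
rewrite [X in _ = _ + X]block_mxEdr [LHS]mxE [X in _ = _ *: X + _]mxE.
by rewrite [X in _ = _ + X]mxE (ord1 i') eqxx !mulr1n /in_x comp_mpolyD comp_mpolyZ.
Qed.

HB.instance Definition _ (L : {scalar {mpoly R[n]}}) :=
  GRing.isLinear.Build R {mpoly R[n]} {mpoly R[n]} _ (extend L)
    (extend_is_linear L).

(* l * L *)
Definition fmul (l L : {scalar {mpoly R[n]}}) (F : {mpoly R[n]}) : R :=
  l (extend L F).

Fact fmul_is_linear (l L : {scalar {mpoly R[n]}}) : scalar (fmul l L).
Proof. by move=> a F G; rewrite /fmul linearP linearP. Qed.

HB.instance Definition _ (l L : {scalar {mpoly R[n]}}) :=
  GRing.isLinear.Build R {mpoly R[n]} R _ (fmul l L) (fmul_is_linear l L).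

End Extension.

(* Main.v *)
Require Import Defs.
From HB Require Import structures.
From mathcomp Require Import all_boot all_order all_algebra.
From mathcomp Require Import fingroup perm ssrcomplements mpoly.
From mathcomp Require Import ring zify.

Set Implicit Arguments.
Unset Strict Implicit.
Unset Printing Implicit Defensive.

Import Order.TTheory GRing.Theory Num.Theory.
Local Open Scope ring_scope.

(** Write D(F) for the bordered determinant whose image under L(y) is L*F, and
    d for a bound on deg F.

    Expanding D(F) along its last row (f(x), F(x)) shows that L*F is congruent
    to F times L*1 modulo the ideal (f), because a difference derivative of the
    constant 1 vanishes ([extend_mod]).  So E'*1 = 1 modulo (f) makes E'*F
    congruent to F.  The last row may also be taken to be (f(y), F(y))
    ([det_last_row]).  With that row, the coefficient of x^u in the f_i term
    is f_i(y) times a polynomial of degree at most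
    delta_f + d - deg f_i - |u|, which E' kills unless |u| <= d - eps - 1,
    while the F term has degree at most delta_f in x ([deg_le_extend]).  This
    is part 1.

    The other parts follow formally from part 1 and from commutativity: if E
    annuls (f)^{<= delta_f+eps} and L annuls (f)^{<= delta_f+dlt}, then
    E*L = L*E up to degree delta_f+dlt+eps+1 ([fmulC]).  To see this, let
    E(x)L(y) act on R[x,y].  Then (E*L).F is its value on D(F), and (L*E).F
    its value on D(F) with x and y exchanged, which is the same determinant
    built from another choice of difference derivatives, namely
    nabla f(y,x) and nabla F(y,x).  It remains to see that this choice does not
    matter.

    Two difference derivatives of the same polynomial differ by a relation
    between the x_k - y_k, and such a relation is a combination of Koszul
    relations of one degree less ([koszul_exact]).  Putting a Koszul relation
    in one column of the determinant turns it, up to sign, into a determinant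
    with the two rows (f(y), F(y)) and (f(x), F(x)) ([minor_exchange]).  By the
    Leibniz formula this is a combination of products g(x) h(y) B(x,y) with g,
    h two different members of the family (f_1, .., f_n, F) and
    deg B <= delta_f + d - deg g - deg h ([vanish_two_rows]).  If g and h are
    f_i and f_j, the degree bound leaves each monomial of B too small a degree
    in x for E not to kill its contribution, or too small a degree in y for L;
    if one of them is F, the other factor is killed ([tensor_vanish]). *)

(** * Total degree *)

Section DegreeCalculus.
Variables (R : comNzRingType) (m : nat).
Implicit Types (d e : int) (p q : {mpoly R[m]}).

Lemma deg_le0 d : deg_le d (0 : {mpoly R[m]}).
Proof. by move=> u; rewrite msupp0. Qed.

Lemma deg_leW d e p : d <= e -> deg_le d p -> deg_le e p.
Proof. by move=> de h u /h /le_trans; apply. Qed.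

Lemma deg_leD d p q : deg_le d p -> deg_le d q -> deg_le d (p + q).
Proof.
by move=> hp hq u /msuppD_le; rewrite mem_cat => /orP[/hp|/hq].
Qed.

Lemma deg_leZ d (a : R) p : deg_le d p -> deg_le d (a *: p).
Proof. by move=> h u /msuppZ_le /h. Qed.

Lemma deg_leN d p : deg_le d p -> deg_le d (- p).
Proof. by rewrite -scaleN1r; apply: deg_leZ. Qed.

Lemma deg_leB d p q : deg_le d p -> deg_le d q -> deg_le d (p - q).
Proof. by move=> hp hq; apply/deg_leD/deg_leN. Qed.

Lemma deg_le_sum (I : Type) (r : seq I) (P : pred I) (F : I -> {mpoly R[m]}) d :
  (forall i, P i -> deg_le d (F i)) -> deg_le d (\sum_(i <- r | P i) F i).
Proof.
move=> h; elim/big_rec: _ => [|i x Pi]; first exact: deg_le0.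
exact/deg_leD/h.
Qed.

Lemma deg_leX d (u : 'X_{1..m}) : (mdeg u)%:Z <= d -> deg_le d ('X_[R, u]).
Proof. by move=> h v /mem_msuppXP <-. Qed.

Lemma deg_leM d e p q : deg_le d p -> deg_le e q -> deg_le (d + e) (p * q).
Proof.
move=> hp hq w /msuppM_le /allpairsP[[u v] /= [/hp hu /hq hv ->]].
by rewrite mdegD; lia.
Qed.

Lemma deg_le1 : deg_le 0 (1 : {mpoly R[m]}).
Proof. by rewrite -mpolyX0; apply: deg_leX; rewrite mdeg0. Qed.

Lemma deg_le_prod (I : finType) (P : pred I) (F : I -> {mpoly R[m]})
    (e : I -> int) :
  (forall i, P i -> deg_le (e i) (F i)) ->
  deg_le (\sum_(i | P i) e i) (\prod_(i | P i) F i).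
Proof.
move=> h; elim/big_rec2: _ => [|i p d Pi]; first exact: deg_le1.
exact/deg_leM/h.
Qed.

Lemma deg_le_sign d (b : bool) p : deg_le d p -> deg_le d ((-1) ^+ b * p).
Proof. by case: b => h; rewrite ?mulN1r ?mul1r //; apply: deg_leN. Qed.

Lemma deg_le_tdeg_self p : deg_le (tdeg p) p.
Proof. by apply/deg_le_tdeg; right. Qed.

Lemma deg_le_lt0 d p : d < 0 -> deg_le d p -> p = 0.
Proof.
move=> d0 h; apply: contraTeq isT => p0; move: (h _ (mlead_supp p0)).
by move: (mdeg _) => k; lia.
Qed.

(** Linear statements about polynomials of bounded degree reduce to monomials of
    bounded degree. *)
Lemma deg_le_ind d (P : {mpoly R[m]} -> Prop) :
    P 0 ->
    (forall c u p, (mdeg u)%:Z <= d -> P p -> P (c *: 'X_[u] + p)) ->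
  forall p, deg_le d p -> P p.
Proof.
move=> P0 PD p hp; rewrite (mpolyE p) big_seq.
by elim/big_rec: _ => // u q /hp; apply: PD.
Qed.

End DegreeCalculus.

Lemma deg_le_linear (R : comNzRingType) (m k : nat) (d e : int)
    (phi : {linear {mpoly R[m]} -> {mpoly R[k]}}) (p : {mpoly R[m]}) :
    (forall u, (mdeg u)%:Z <= d -> deg_le e (phi 'X_[u])) ->
  deg_le d p -> deg_le e (phi p).
Proof.
move=> h; elim/deg_le_ind: p / => [|c u p hu ih].
  by rewrite linear0; apply: deg_le0.
by rewrite linearP; apply: deg_leD ih; apply/deg_leZ/h.
Qed.

(** * Koszul relations between the differences of the variables *)

Section MonomialExtension.
Variables (R : comNzRingType) (m : nat) (V : lmodType R) (h : 'X_{1..m} -> V).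

Definition mnm_extend (p : {mpoly R[m]}) : V := \sum_(u <- msupp p) p@_u *: h u.

Let mnm_extendE i p : (msize p <= i)%N ->
  mnm_extend p = \sum_(u : 'X_{1..m < i}) p@_u *: h u.
Proof.
move=> le_pi; set I : subFinType _ := 'X_{1..m < i}.
rewrite /mnm_extend (big_mksub I) ?msupp_uniq //=; first last.
  by move=> u /msize_mdeg_lt /leq_trans; apply.
by rewrite big_rmcond //= => u /memN_msupp_eq0 ->; rewrite scale0r.
Qed.

Fact mnm_extend_is_linear : linear mnm_extend.
Proof.
move=> a p q; pose i := maxn (msize (a *: p + q)) (maxn (msize p) (msize q)).
rewrite !(@mnm_extendE i) ?leq_max ?leqnn ?orbT //.
rewrite scaler_sumr -big_split; apply: eq_bigr => u _ /=.
by rewrite mcoeffD mcoeffZ scalerDl scalerA.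
Qed.

HB.instance Definition _ :=
  GRing.isLinear.Build R {mpoly R[m]} V _ mnm_extend mnm_extend_is_linear.

Lemma mnm_extendX u : mnm_extend 'X_[u] = h u.
Proof. by rewrite /mnm_extend msuppX big_seq1 mcoeffX eqxx scale1r. Qed.

End MonomialExtension.

Section DividedDifference.
Variables (R : comNzRingType) (n : nat).
Implicit Types (k l : 'I_n) (G : {mpoly R[n + n]}).

(** The quotient of u - u(x_k := y_k) by x_k - y_k, from the geometric sum
    (a^m - b^m) / (a - b) with a = x_k and b = y_k. *)
Definition divdiff_mnm k (u : 'X_{1..n + n}) : {mpoly R[n + n]} :=
  \sum_(i < u (lshift n k))
    'X_[(u - U_(lshift n k) *+ i.+1 + U_(rshift n k) *+ i)%MM].

Definition divdiff k : {mpoly R[n + n]} -> {mpoly R[n + n]} :=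
  mnm_extend (divdiff_mnm k).

HB.instance Definition _ k := GRing.Linear.on (divdiff k).

Let mnmE := (@mnmDE (n + n), @mnmBE (n + n), @mulmnE (n + n), @mnm1E (n + n)).

(** The twisted Leibniz rule of the divided difference, for multiplication by
    x_k: the first term of each geometric sum is split off. *)
Lemma divdiff_mulx k G : divdiff k (Xvar R k * G) = G + Yvar R k * divdiff k G.
Proof.
elim/mpolyind: G => [|c u G _ _ ih]; first by rewrite !(mulr0, linear0, addr0).
rewrite mulrDr linearD /= ih linearD /= linearZ /= mulrDr addrACA; congr (_ + _).
rewrite -!scalerAr linearZ /= -scalerDr; congr (_ *: _).
rewrite /Xvar /Yvar -!mpolyXD /divdiff !mnm_extendX /divdiff_mnm.
rewrite mnmDE mnm1E eqxx add1n big_ord_recl mulr_sumr; congr (_ + _).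
  by congr 'X_[_]; apply/mnmP => j; rewrite !mnmE /=; lia.
apply: eq_bigr => i _; rewrite -mpolyXD; congr 'X_[_]; apply/mnmP => j.
by rewrite !mnmE /= /bump /= add1n; do 2!case: eqP => ?; lia.
Qed.

Lemma divdiff_mulX k (j : 'I_(n + n)) G :
  j != lshift n k -> divdiff k ('X_j * G) = 'X_j * divdiff k G.
Proof.
move=> jk; elim/mpolyind: G => [|c u G _ _ ih].
  by rewrite !(mulr0, linear0).
rewrite mulrDr linearD /= ih linearD /= linearZ /= mulrDr; congr (_ + _).
rewrite -!scalerAr linearZ /=; congr (_ *: _).
rewrite -mpolyXD /divdiff !mnm_extendX /divdiff_mnm mnmDE mnm1E (negPf jk) add0n.
rewrite mulr_sumr; apply: eq_bigr => i _; rewrite -mpolyXD; congr 'X_[_].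
apply/mnmP => h; rewrite !mnmE.
case: (eqVneq j h) => [jh|_] /=; last by lia.
by rewrite -jh [lshift n k == j]eq_sym (negPf jk) /=; lia.
Qed.

Lemma divdiff_z k G : divdiff k ((Xvar R k - Yvar R k) * G) = G.
Proof.
rewrite mulrBl linearB /= divdiff_mulx /Yvar divdiff_mulX ?addrK //.
by rewrite eq_sym eq_lrshift.
Qed.

Lemma divdiff_mulz k l G : l != k ->
  divdiff k ((Xvar R l - Yvar R l) * G) = (Xvar R l - Yvar R l) * divdiff k G.
Proof.
move=> lk; rewrite !mulrBl linearB /= /Xvar /Yvar !divdiff_mulX //.
by rewrite eq_sym eq_lrshift.
Qed.

Lemma deg_le_divdiff k d G : deg_le d G -> deg_le (d - 1) (divdiff k G).
Proof.
apply: deg_le_linear => u hu; rewrite /= /divdiff mnm_extendX.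
apply: deg_le_sum => i _; apply: deg_leX.
have le_u : (U_(lshift n k) *+ i.+1 <= u)%MM.
  by apply/mnm_lepP => j; rewrite !mnmE; case: eqP => [<-|_] //=; rewrite mul1n.
have := congr1 mdeg (submK le_u).
by rewrite !mdegD !mdegMn !mdeg1; move: (mdeg _) (mdeg u) hu => a b; lia.
Qed.

(** The sequence of the x_k - y_k is regular, so its relations are generated by
    the trivial ones.  The divided differences make this explicit and control
    the degrees: they solve the relation for one component in terms of the
    others, and subtracting the corresponding trivial relations removes that
    component and lets an induction on the number of components go on. *)
Lemma koszul_exact (e : int) (c : 'I_n -> {mpoly R[n + n]}) :
    (forall k, deg_le e (c k)) ->
    \sum_k (Xvar R k - Yvar R k) * c k = 0 ->
  exists2 s : 'I_n -> 'I_n -> {mpoly R[n + n]},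
    forall k l, deg_le (e - 1) (s k l) &
    forall k, c k = \sum_l (Xvar R l - Yvar R l) * (s k l - s l k).
Proof.
pose z k := Xvar R k - Yvar R k; rewrite -/z.
suff /(_ n c) H : forall m (c : 'I_n -> {mpoly R[n + n]}),
    (forall k, (m <= k)%N -> c k = 0) ->
    (forall k, deg_le e (c k)) -> \sum_k z k * c k = 0 ->
    exists2 s : 'I_n -> 'I_n -> {mpoly R[n + n]},
      forall k l, deg_le (e - 1) (s k l) &
      forall k, c k = \sum_l z l * (s k l - s l k).
  by move=> hd h0; apply: H => // k; rewrite leqNgt ltn_ord.
elim=> [|m IH] {}c c0 hd h0.
  exists (fun _ _ => 0) => [k l|k]; first exact: deg_le0.
  by rewrite c0 // big1 // => l _; rewrite subrr mulr0.
case: (ltnP m n) => [mn|nm]; last first.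
  by apply: IH => // k mk; have := ltn_ord k; rewrite ltnNge (leq_trans nm mk).
pose p := Ordinal mn.
(* The divided difference in x_p of the relation solves it for c p. *)
have cp : c p = - \sum_(k | k != p) z k * divdiff p (c k).
  apply/eqP; rewrite -addr_eq0; have := congr1 (divdiff p) h0.
  rewrite linear0 linear_sum (bigD1 p) //= divdiff_z => h; rewrite -[X in _ == X]h.
  by apply/eqP; congr (_ + _); apply: eq_bigr => k kp; rewrite divdiff_mulz.
pose c' k := if k == p then 0 else c k - z p * divdiff p (c k).
have degz k : deg_le 1 (z k).
  by apply: deg_leB; apply: deg_leX; rewrite mdeg1.
have [|k||s' hs' cs'] := IH c'.
- move=> k mk; rewrite /c'; case: eqVneq => // kp; rewrite c0.
    by rewrite linear0 mulr0 subr0.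
  by rewrite ltn_neqAle mk andbT; apply: contraNneq kp => mk'; apply/eqP/val_inj.
- rewrite /c'; case: eqP => _; first exact: deg_le0.
  apply: deg_leB => //; have -> : e = 1 + (e - 1) by rewrite addrC subrK.
  by apply: deg_leM; last exact: deg_le_divdiff.
- rewrite (bigD1 p) //= /c' eqxx mulr0 add0r.
  have -> : \sum_(k | k != p) z k * c' k =
            \sum_(k | k != p) z k * c k -
            z p * \sum_(k | k != p) z k * divdiff p (c k).
    rewrite mulr_sumr -sumrB; apply: eq_bigr => k /negPf kp.
    by rewrite /c' kp mulrBr mulrCA.
  by rewrite -mulrN -cp addrC -[RHS]h0 [RHS](bigD1 p).
pose t k l := if (k != p) && (l == p) then divdiff p (c k) else 0.
exists (fun k l => s' k l + t k l) => [k l|k].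
  apply: deg_leD => //; rewrite /t.
  by case: ifP => _; [apply: deg_le_divdiff|apply: deg_le0].
have -> : \sum_l z l * (s' k l + t k l - (s' l k + t l k)) =
    c' k + \sum_l z l * (t k l - t l k).
  by rewrite cs' -big_split; apply: eq_bigr => l _; rewrite /= -mulrDr;
    congr (_ * _); ring.
rewrite /c' /t; case: (eqVneq k p) => [->|kp] /=.
  rewrite add0r cp -sumrN [RHS](bigD1 p) //= eqxx subrr mulr0 add0r.
  by apply: eq_bigr => l lp; rewrite lp sub0r mulrN.
rewrite (bigD1 p) //= eqxx andbF subr0 big1 ?addr0 ?subrK // => l lp.
by rewrite (negPf lp) andbF subrr mulr0.
Qed.

End DividedDifference.

(** * Dependence of the bordered determinant on the difference derivatives *)

Lemma neq_last (n : nat) (r : 'I_(n + 1)) :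
  r != rshift n ord0 -> exists k, r = lshift 1 k.
Proof.
by case: (split_ordP r) => k ->; [exists k|rewrite (ord1 k) eqxx].
Qed.

Section MinorExchange.
Variables (S : comNzRingType) (n : nat).

Lemma eq_cofactor (m : nat) (A B : 'M[S]_m) i j :
    (forall r c, r != i -> c != j -> A r c = B r c) ->
  cofactor A i j = cofactor B i j.
Proof.
move=> AB; rewrite /cofactor; congr (_ * \det _); apply/matrixP => r c.
by rewrite !mxE AB // eq_sym neq_lift.
Qed.

(** What is left of [M], up to sign, when the Koszul relation z_l e_k - z_k e_l is
    put in its column [i] and 0 in its last row there.  Column [i] takes
    precedence over row [l]. *)
Definition two_rows_mx (M : 'M[S]_(n + 1)) (b : 'rV_(n + 1)) i (k l : 'I_n) :=
  \matrix_(r, c) if c == i then (r == lshift 1 k)%:R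
                 else if r == lshift 1 l then b 0 c else M r c.

(** Let X be M with column i replaced by e_k, so that det X is the first
    cofactor.  The row w = (z, -1) satisfies w X = - b off column i, because
    z A = a - b, and w X = z_k in column i.  Multiplying w X by the adjugate of X then gives
    z_l det X as the expansion along row l of a determinant with row l equal
    to w X. *)
Lemma minor_exchange (A : 'M[S]_(n, n + 1)) (a b : 'rV_(n + 1)) (z : 'rV_n)
    i (k l : 'I_n) (M := col_mx A a) :
    z *m A = a - b -> k != l ->
  z 0 l * cofactor M (lshift 1 k) i - z 0 k * cofactor M (lshift 1 l) i =
  - \det (two_rows_mx M b i k l).
Proof.
move=> zA kl;
pose X := \matrix_(r, c) if c == i then (r == lshift 1 k)%:R else M r c.
have detX : \det X = cofactor M (lshift 1 k) i.
  rewrite (expand_det_col X i) (bigD1 (lshift 1 k)) //= mxE !eqxx mul1r big1.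
    rewrite addr0; apply: eq_cofactor => r c _ /negPf ci.
    by rewrite mxE ci.
  by move=> r /negPf rk; rewrite mxE eqxx rk mul0r.
have cofX : cofactor X (lshift 1 l) i = cofactor M (lshift 1 l) i.
  by apply: eq_cofactor => r c _ /negPf ci; rewrite mxE ci.
pose w : 'rV_(n + 1) := row_mx z (- 1%:M).
have wl j : w 0 (lshift 1 j) = z 0 j by rewrite row_mxEl.
have wr : w 0 (rshift n ord0) = - 1 by rewrite row_mxEr !mxE.
have wX c : (w *m X) 0 c = if c == i then z 0 k else - b 0 c.
  rewrite mxE big_split_ord big_ord1 /= wr [X _ _]mxE mulN1r.
  case: eqVneq => [ci|ci].
    rewrite eq_rlshift subr0 (bigD1 k) //= wl mxE ci !eqxx mulr1 big1 ?addr0 //.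
    by move=> j jk; rewrite wl mxE eqxx eq_lshift (negPf jk) mulr0.
  have zAc : \sum_j z 0 j * A j c = a 0 c - b 0 c.
    by have := congr1 (fun D : 'rV_(n + 1) => D 0 c) zA; rewrite !mxE.
  have -> : \sum_(j < n) w 0 (lshift 1 j) * X (lshift 1 j) c = a 0 c - b 0 c.
    rewrite -zAc; apply: eq_bigr => j _.
    by rewrite wl mxE (negPf ci) /M col_mxEu.
  by rewrite /M col_mxEd addrAC subrr sub0r.
have -> : z 0 l * cofactor M (lshift 1 k) i =
    \sum_c (w *m X) 0 c * cofactor X (lshift 1 l) c.
  have -> : z 0 l * cofactor M (lshift 1 k) i = (\det X *: w) 0 (lshift 1 l).
    by rewrite mxE wl detX mulrC.
  rewrite -mul_mx_scalar -mul_mx_adj mulmxA [LHS]mxE.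
  by apply: eq_bigr => c _; rewrite [(\adj X) _ _]mxE.
rewrite (bigD1 i) //= wX eqxx cofX addrAC subrr add0r.
set Z := two_rows_mx _ _ _ _ _.
have Zl c : Z (lshift 1 l) c = if c == i then 0 else b 0 c.
  by rewrite mxE eqxx eq_lshift [l == k]eq_sym (negPf kl).
rewrite (expand_det_row Z (lshift 1 l)) [X in _ = - X](bigD1 i) //=.
rewrite Zl eqxx mul0r add0r.
rewrite -sumrN; apply: eq_bigr => c ci; rewrite wX Zl (negPf ci) mulNr.
congr (- (_ * _)); apply: eq_cofactor => r c' /negPf rl _.
by rewrite [RHS]mxE rl mxE.
Qed.

End MinorExchange.

(** In this section [a] and [b] stand for the rows (f(x), F(x)) and
    (f(y), F(y)), [d] for their degrees, and [T] for the functional E(x)L(y). *)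
Section ChoiceOfDerivatives.
Variables (R : comNzRingType) (n : nat) (d : 'I_(n + 1) -> int).
Variables a b : 'rV[{mpoly R[n + n]}]_(n + 1).
Variable T : {scalar {mpoly R[n + n]}}.

Let z : 'rV[{mpoly R[n + n]}]_n := \row_k (Xvar R k - Yvar R k).

Definition derivative_mx (A : 'M[{mpoly R[n + n]}]_(n, n + 1)) :=
  (forall k c, deg_le (d c - 1) (A k c)) /\ z *m A = a - b.

Let D : int := \sum_c (d c - 1).

Hypothesis T0 : forall i j B, i != j -> deg_le (D + 1 - d i - d j) B ->
  T (a 0 i * b 0 j * B) = 0.

(** A term of the Leibniz formula is nonzero only if its permutation sends row k
    to column i; it then has one factor from [a], one from [b] and one from each
    column other than i and theirs.  The degree lost by leaving out column i is
    made up for by [s], up to the unit that a Koszul coefficient loses. *)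
Lemma vanish_two_rows A i (k l : 'I_n) s :
    derivative_mx A -> k != l -> deg_le (d i - 2) s ->
  T (s * \det (two_rows_mx (col_mx A a) b i k l)) = 0.
Proof.
move=> [degA _] kl degs; pose last : 'I_(n + 1) := rshift n ord0.
rewrite /determinant mulr_sumr linear_sum big1 // => /= g _.
set Z := two_rows_mx _ _ _ _ _.
have Zik r : (r == lshift 1 k) = false -> g r = i -> Z r (g r) = 0.
  by move=> rk gr; rewrite mxE gr eqxx rk.
have [gk|gk] := eqVneq (g (lshift 1 k)) i; last first.
  pose r := (g^-1)%g i; have gr : g r = i by rewrite permKV.
  rewrite (bigD1 r) //= Zik ?mul0r ?mulr0 ?linear0 //.
  by apply: contraNF gk => /eqP <-; rewrite gr.
have ne r : r != lshift 1 k -> (g r == i) = false.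
  by move=> rk; rewrite -gk (inj_eq perm_inj) (negPf rk).
have lk : lshift 1 l != lshift 1 k by rewrite eq_lshift eq_sym.
have tk : last != lshift 1 k by rewrite eq_rlshift.
have tl : last != lshift 1 l by rewrite eq_rlshift.
rewrite (bigD1 (lshift 1 k)) //= (bigD1 (lshift 1 l)) //=.
rewrite (bigD1 last) /=; last by rewrite tk tl.
have -> : Z (lshift 1 k) (g (lshift 1 k)) = 1 by rewrite mxE gk !eqxx.
have -> : Z (lshift 1 l) (g (lshift 1 l)) = b 0 (g (lshift 1 l)).
  by rewrite mxE ne // eqxx.
have -> : Z last (g last) = a 0 (g last).
  by rewrite mxE ne // (negPf tl) col_mxEd.
set P := (X in _ * (1 * (_ * (_ * X)))).
rewrite (_ : s * _ =
  a 0 (g last) * b 0 (g (lshift 1 l)) * ((-1) ^+ g * (s * P))).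
  apply: T0; first by rewrite (inj_eq perm_inj).
  apply: deg_le_sign.
  have -> : D + 1 - d (g last) - d (g (lshift 1 l)) =
      (d i - 2) +
      \sum_(r | (r != lshift 1 k) && (r != lshift 1 l) && (r != last))
        (d (g r) - 1).
    rewrite /D (reindex_inj (@perm_inj _ g)) (bigD1 (lshift 1 k)) //=.
    rewrite (bigD1 (lshift 1 l)) //= (bigD1 last) /=; last by rewrite tk tl.
    by rewrite gk; set X := \sum_(_ | _) _; lia.
  apply: deg_leM degs _; apply: deg_le_prod => r /andP[/andP[rk rl] rt].
  rewrite mxE ne // (negPf rl); case: (neq_last rt) => r' ->.
  by rewrite col_mxEu.
by rewrite mul1r; move: ((-1) ^+ _) (a _ _) (b _ _) P => u x y p; ring.
Qed.

(** Pairing each Koszul relation with the cofactors of column i leaves the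
    differences treated by [minor_exchange]. *)
Lemma vanish_koszul_col A i (s : 'I_n -> 'I_n -> {mpoly R[n + n]}) :
    derivative_mx A -> (forall k l, deg_le (d i - 2) (s k l)) ->
  T (\sum_k (\sum_l z 0 l * (s k l - s l k)) *
            cofactor (col_mx A a) (lshift 1 k) i) = 0.
Proof.
move=> hA hs; set C := fun k : 'I_n => cofactor (col_mx A a) (lshift 1 k) i.
have -> : \sum_k (\sum_l z 0 l * (s k l - s l k)) * C k =
    \sum_k \sum_l s k l * (z 0 l * C k - z 0 k * C l).
  transitivity (\sum_k \sum_l s k l * (z 0 l * C k) -
                \sum_k \sum_l s l k * (z 0 l * C k)).
    rewrite -sumrB; apply: eq_bigr => k _; rewrite mulr_suml -sumrB.
    by apply: eq_bigr => l _; ring.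
  rewrite [X in _ - X]exchange_big -sumrB; apply: eq_bigr => k _.
  by rewrite -sumrB; apply: eq_bigr => l _; rewrite /= mulrBr.
rewrite linear_sum big1 // => k _; rewrite linear_sum big1 // => l _.
have [->|kl] := eqVneq k l; first by rewrite subrr mulr0 linear0.
have [_ zA] := hA; rewrite (minor_exchange _ zA kl) mulrN linearN /=.
by rewrite vanish_two_rows // oppr0.
Qed.

Lemma det_derivative_col A B i :
    derivative_mx A -> derivative_mx B ->
    (forall k c, c != i -> A k c = B k c) ->
  T (\det (col_mx A a)) = T (\det (col_mx B a)).
Proof.
move=> hA hB AB; apply/eqP; rewrite -subr_eq0 -linearB /=.
have [w wA] : exists w, forall r, cofactor (col_mx A a) r i = w r by eexists.
have wB r : cofactor (col_mx B a) r i = w r.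
  rewrite -wA; apply: eq_cofactor => r' c _ ci; case: (split_ordP r') => j ->.
    by rewrite !col_mxEu AB.
  by rewrite !col_mxEd.
have detE C : (forall r, cofactor (col_mx C a) r i = w r) ->
    \det (col_mx C a) =
    \sum_k C k i * w (lshift 1 k) + a 0 i * w (rshift n ord0).
  move=> wC; rewrite (expand_det_col _ i) big_split_ord big_ord1 col_mxEd wC.
  by congr (_ + _); apply: eq_bigr => k _; rewrite col_mxEu wC.
rewrite (detE A wA) (detE B wB) opprD addrACA subrr addr0.
pose c k := A k i - B k i.
have [k||s hs cs] := @koszul_exact R n (d i - 1) c.
- by apply: deg_leB; [apply: hA.1|apply: hB.1].
- have := congr1 (fun D : 'rV__ => D 0 i) (etrans hA.2 (esym hB.2)).
  rewrite /= !mxE => /eqP; rewrite -subr_eq0 -sumrB => /eqP h.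
  by rewrite -[RHS]h; apply: eq_bigr => k _; rewrite !mxE mulrBr.
have hs' k l : deg_le (d i - 2) (s k l) by apply: deg_leW (hs k l); lia.
apply/eqP; apply: etrans (vanish_koszul_col hA hs'); congr (T _).
rewrite -sumrB; apply: eq_bigr => k _.
rewrite -mulrBl -/(c k) cs wA; congr (_ * _).
by apply: eq_bigr => l _; rewrite mxE.
Qed.

Lemma det_derivative_mx A B : derivative_mx A -> derivative_mx B ->
  T (\det (col_mx A a)) = T (\det (col_mx B a)).
Proof.
suff H m : forall A, derivative_mx A -> derivative_mx B ->
    (forall k (c : 'I_(n + 1)), (m <= c)%N -> A k c = B k c) ->
    T (\det (col_mx A a)) = T (\det (col_mx B a)).
  by move=> hA hB; apply: (H (n + 1)%N) => // k c; rewrite leqNgt ltn_ord.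
elim: m => [|m IH] {}A hA hB AB.
  by congr (T (\det (col_mx _ _))); apply/matrixP => k c; apply: AB.
pose A' := \matrix_(k, c) if c == m :> nat then B k c else A k c.
have hA' : derivative_mx A'.
  split=> [k c|]; first by rewrite mxE; case: ifP => _; [apply: hB.1|apply: hA.1].
  apply/rowP => c; have [cm|cm] := eqVneq (c : nat) m.
    rewrite -hB.2 !mxE; apply: eq_bigr => k _; by rewrite [A' _ _]mxE cm eqxx.
  rewrite -hA.2 !mxE; apply: eq_bigr => k _; by rewrite [A' _ _]mxE (negPf cm).
rewrite -(IH A') //; last first.
  move=> k c mc; rewrite mxE; case: eqVneq => // cm; apply: AB.
  by rewrite ltn_neqAle eq_sym cm.
case: (ltnP m (n + 1)) => [mn|nm].
  apply: (@det_derivative_col A A' (Ordinal mn)) => // k c ci.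
  by rewrite mxE ifN //; apply: contra ci => /eqP cm; apply/eqP/val_inj.
congr (T (\det (col_mx _ _))); apply/matrixP => k c; rewrite mxE ifN //.
by rewrite neq_ltn (leq_trans (ltn_ord c) nm).
Qed.

End ChoiceOfDerivatives.

(** * Functionals and the exchange of the two copies of the variables *)

Section TwoCopiesCalculus.
Variables (R : comNzRingType) (n : nat).
Implicit Types (l L : {scalar {mpoly R[n]}}) (A B F : {mpoly R[n]}).
Implicit Types (G : {mpoly R[n + n]}).

Lemma in_xM A B : in_x (A * B) = in_x A * in_x B.
Proof. exact: rmorphM. Qed.

Lemma in_yM A B : in_y (A * B) = in_y A * in_y B.
Proof. exact: rmorphM. Qed.

Lemma in_x1 : in_x 1 = 1 :> {mpoly R[n + n]}.
Proof. exact: rmorph1. Qed.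

Lemma mpolyX_xy (u : 'X_{1..n + n}) :
  'X_[u] = in_x 'X_[mnm_x u] * in_y 'X_[mnm_y u] :> {mpoly R[n + n]}.
Proof.
rewrite in_xX in_yX -mpolyXD; congr 'X_[_]; apply/mnmP => i; rewrite !mnmE.
by case: (split_ordP i) => k ->; rewrite mnmE ?addn0.
Qed.

Lemma mdeg_xy (u : 'X_{1..n + n}) :
  mdeg u = (mdeg (mnm_x u) + mdeg (mnm_y u))%N.
Proof.
rewrite !mdegE big_split_ord; congr (_ + _)%N.
  by apply: eq_bigr => k _; rewrite mnmE.
by apply: eq_bigr => k _; rewrite mnmE.
Qed.

Lemma apply_y_mulX L A B (u : 'X_{1..n + n}) :
  apply_y L (in_x A * in_y B * 'X_[u]) =
  L (B * 'X_[mnm_y u]) *: (A * 'X_[mnm_x u]).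
Proof. by rewrite mpolyX_xy mulrACA -in_xM -in_yM apply_y_mul. Qed.

Lemma apply_y_mull L A G : apply_y L (in_x A * G) = A * apply_y L G.
Proof.
elim/mpolyind: G => [|c u G _ _ ih]; first by rewrite !(mulr0, linear0).
rewrite mulrDr linearD /= ih linearD mulrDr; congr (_ + _).
rewrite -scalerAr !linearZ -scalerAr; congr (_ *: _).
by rewrite (mpolyX_xy u) mulrA -in_xM /= !apply_y_mul scalerAr.
Qed.

(** The functional l(x)L(y) on R[x,y]. *)
Definition tensor l L G : R := l (apply_y L G).

Fact tensor_is_linear l L : scalar (tensor l L).
Proof. by move=> a G H; rewrite /tensor linearP linearP. Qed.

HB.instance Definition _ l L :=
  GRing.isLinear.Build R {mpoly R[n + n]} R _ (tensor l L) (tensor_is_linear l L).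

Lemma tensor_mulX l L A B (u : 'X_{1..n + n}) :
  tensor l L (in_x A * in_y B * 'X_[u]) =
  l (A * 'X_[mnm_x u]) * L (B * 'X_[mnm_y u]).
Proof. by rewrite /tensor apply_y_mulX linearZ /= mulrC. Qed.

Definition swap_ord (i : 'I_(n + n)) : 'I_(n + n) :=
  match split i with inl k => rshift n k | inr k => lshift n k end.

Definition swap_xy G : {mpoly R[n + n]} :=
  G \mPo [tuple 'X_(swap_ord i) | i < n + n].

HB.instance Definition _ := GRing.LRMorphism.copy swap_xy
  (comp_mpoly [tuple 'X_(swap_ord i) | i < n + n]).

Lemma swap_xyU i : swap_xy 'X_i = 'X_(swap_ord i).
Proof. by rewrite /swap_xy comp_mpolyXU -tnth_nth tnth_mktuple. Qed.

Lemma swap_Xvar k : swap_xy (Xvar R k) = Yvar R k.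
Proof. by rewrite swap_xyU /swap_ord -[lshift _ _]/(unsplit (inl _)) unsplitK. Qed.

Lemma swap_Yvar k : swap_xy (Yvar R k) = Xvar R k.
Proof. by rewrite swap_xyU /swap_ord -[rshift _ _]/(unsplit (inr _)) unsplitK. Qed.

Lemma swap_in_x F : swap_xy (in_x F) = in_y F.
Proof.
elim/mpolyind: F => [|c u F _ _ ih].
  by rewrite /in_x /in_y !comp_mpoly0 linear0.
rewrite /in_x /in_y !comp_mpolyD !comp_mpolyZ linearD linearZ /= ih.
congr (_ *: _ + _); rewrite !comp_mpolyX rmorph_prod; apply: eq_bigr => k _.
by rewrite rmorphXn /= !tnth_mktuple swap_Xvar.
Qed.

Lemma swap_in_y F : swap_xy (in_y F) = in_x F.
Proof.
elim/mpolyind: F => [|c u F _ _ ih].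
  by rewrite /in_x /in_y !comp_mpoly0 linear0.
rewrite /in_x /in_y !comp_mpolyD !comp_mpolyZ linearD linearZ /= ih.
congr (_ *: _ + _); rewrite !comp_mpolyX rmorph_prod; apply: eq_bigr => k _.
by rewrite rmorphXn /= !tnth_mktuple swap_Yvar.
Qed.

Lemma deg_le_swap d G : deg_le d G -> deg_le d (swap_xy G).
Proof.
apply: deg_le_linear => u hu; rewrite /= /swap_xy comp_mpolyX.
apply: deg_leW hu _; rewrite mdegE (big_morph Posz PoszD erefl).
apply: deg_le_prod => i _; rewrite tnth_mktuple mpolyXn; apply: deg_leX.
by rewrite mdegMn mdeg1 mul1n.
Qed.

Lemma tensor_swap l L G : tensor l L (swap_xy G) = tensor L l G.
Proof.
elim/mpolyind: G => [|c u G _ _ ih]; first by rewrite !linear0.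
rewrite !linearP /= ih; congr (_ * _ + _).
rewrite mpolyX_xy rmorphM /= swap_in_x swap_in_y mulrC /tensor !apply_y_mul.
by rewrite !linearZ /= mulrC.
Qed.

End TwoCopiesCalculus.

(** A unipotent matrix on the left subtracts z A from the last row. *)
Lemma det_last_row (S : comNzRingType) (n : nat) (z : 'rV[S]_n)
    (A : 'M_(n, n + 1)) (a b : 'rV_(n + 1)) :
  z *m A = a - b -> \det (col_mx A a) = \det (col_mx A b).
Proof.
move=> zA; have -> : col_mx A b = block_mx 1%:M 0 (- z) 1%:M *m col_mx A a.
  by rewrite mul_block_col !mul1mx mul0mx addr0 mulNmx zA opprB subrK.
by rewrite det_mulmx det_lblock !det1 !mul1r.
Qed.

Lemma deg_le_cofactor (R : comNzRingType) (m p : nat) (e : 'I_p -> int)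
    (A : 'M[{mpoly R[m]}]_p) r0 c :
    (forall r c', r != r0 -> deg_le (e c') (A r c')) ->
  deg_le (\sum_(c' | c' != c) e c') (cofactor A r0 c).
Proof.
move=> hA; rewrite expand_cofactor; apply: deg_le_sum => s /eqP sc.
apply: deg_le_sign; rewrite (reindex_inj (@perm_inj _ s)) /=.
rewrite (eq_bigl (fun k => r0 != k)) => [|k].
  by apply: deg_le_prod => k kr; apply: hA; rewrite eq_sym.
by rewrite -sc (inj_eq perm_inj) eq_sym.
Qed.

(** * The extension operation *)

Section ExtensionOperation.
Variables (R : comNzRingType) (n : nat) (f : 'I_n -> {mpoly R[n]}).
Variable Df : 'M[{mpoly R[n + n]}]_n.
Hypothesis hDf : forall i, diff_derivative (f i) (col i Df).
Variable nabla : 'I_n -> {linear {mpoly R[n]} -> {mpoly R[n + n]}}.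
Hypothesis hnabla : forall F, diff_derivative F (nabla_col nabla F).
Implicit Types (F : {mpoly R[n]}) (L E : {scalar {mpoly R[n]}}) (d : int).

Lemma in_idealD p q : in_ideal f p -> in_ideal f q -> in_ideal f (p + q).
Proof.
move=> [g ->] [h ->]; exists (fun i => g i + h i).
by rewrite -big_split; apply: eq_bigr => i _; rewrite mulrDr.
Qed.

Lemma in_idealMl p q : in_ideal f q -> in_ideal f (p * q).
Proof.
move=> [g ->]; exists (fun i => p * g i).
by rewrite mulr_sumr; apply: eq_bigr => i _; rewrite mulrCA.
Qed.

Lemma in_idealN p : in_ideal f p -> in_ideal f (- p).
Proof. by rewrite -mulN1r; apply: in_idealMl. Qed.

Lemma in_ideal_leW d p : in_ideal_le f d p -> in_ideal f p /\ deg_le d p.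
Proof.
case=> g hg ->; split; first by exists g.
apply: deg_le_sum => i _; have -> : d = tdeg (f i) + (d - tdeg (f i)) by lia.
by apply: deg_leM; first exact: deg_le_tdeg_self.
Qed.

Lemma in_ideal_le_mulX d i (u : 'X_{1..n}) :
  (mdeg u)%:Z <= d - tdeg (f i) -> in_ideal_le f d (f i * 'X_[u]).
Proof.
move=> hu; exists (fun j => if j == i then 'X_[u] else 0) => [j|].
  by case: eqP => [->|_]; [apply: deg_leX|apply: deg_le0].
rewrite (bigD1 i) //= eqxx big1 ?addr0 // => j /negPf ->; exact: mulr0.
Qed.

Definition derivs F : 'M[{mpoly R[n + n]}]_(n, n + 1) :=
  row_mx Df (nabla_col nabla F).
Definition row_x F : 'rV[{mpoly R[n + n]}]_(n + 1) :=
  row_mx (\row_i in_x (f i)) (in_x F)%:M.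
Definition row_y F : 'rV[{mpoly R[n + n]}]_(n + 1) :=
  row_mx (\row_i in_y (f i)) (in_y F)%:M.

Definition extended F (c : 'I_(n + 1)) : {mpoly R[n]} :=
  match split c with inl i => f i | inr _ => F end.
Definition degs d (c : 'I_(n + 1)) : int :=
  match split c with inl i => tdeg (f i) | inr _ => d end.

Lemma extended_l F i : extended F (lshift 1 i) = f i.
Proof. by rewrite /extended -[lshift _ _]/(unsplit (inl _)) unsplitK. Qed.
Lemma extended_r F i : extended F (rshift n i) = F.
Proof. by rewrite /extended -[rshift _ _]/(unsplit (inr _)) unsplitK. Qed.
Lemma degs_l d i : degs d (lshift 1 i) = tdeg (f i).
Proof. by rewrite /degs -[lshift _ _]/(unsplit (inl _)) unsplitK. Qed.
Lemma degs_r d i : degs d (rshift n i) = d.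
Proof. by rewrite /degs -[rshift _ _]/(unsplit (inr _)) unsplitK. Qed.

Lemma row_xE F c : row_x F 0 c = in_x (extended F c).
Proof.
case: (split_ordP c) => i ->; first by rewrite row_mxEl mxE extended_l.
by rewrite row_mxEr mxE (ord1 i) extended_r.
Qed.

Lemma row_yE F c : row_y F 0 c = in_y (extended F c).
Proof.
case: (split_ordP c) => i ->; first by rewrite row_mxEl mxE extended_l.
by rewrite row_mxEr mxE (ord1 i) extended_r.
Qed.

Lemma sum_degs d : \sum_c (degs d c - 1) = delta f + (d - 1).
Proof.
rewrite big_split_ord big_ord1 degs_r; congr (_ + _).
by apply: eq_bigr => i _; rewrite degs_l.
Qed.

Lemma derivs_mx d F : deg_le d F ->
  derivative_mx (degs d) (row_x F) (row_y F) (derivs F).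
Proof.
move=> hF; split=> [k c|].
  case: (split_ordP c) => i ->.
    by rewrite row_mxEl degs_l; have := (hDf i).1 k; rewrite mxE.
  rewrite row_mxEr degs_r (ord1 i); have := (hnabla F).1 k.
  case: (iffLR (deg_le_tdeg d F) hF) => [->|le_d]; last by apply: deg_leW; lia.
  by rewrite mxE linear0 => _; apply: deg_le0.
rewrite mul_mx_row /row_x /row_y opp_row_mx add_row_mx; congr row_mx.
  apply/rowP => i; rewrite !mxE (hDf i).2; apply: eq_bigr => k _.
  by rewrite !mxE.
apply/rowP => i; rewrite !mxE (ord1 i) /= !mulr1n (hnabla F).2.
by apply: eq_bigr => k _; rewrite !mxE.
Qed.

Lemma extendE L F :
  extend f Df nabla L F = apply_y L (\det (col_mx (derivs F) (row_x F))).
Proof. by []. Qed.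

(** If both factors belong to f, say f_i(x) and f_j(y), a monomial x^u y^v of B
    can escape both E and L only if deg f_i + |u| > delta_f + eps and
    deg f_j + |v| > delta_f + dlt, whose sum exceeds the bound on the total
    degree.  If one factor is F, the bound on B alone lets the functional that
    acts on the other factor kill it. *)
Lemma tensor_vanish E L (d eps dlt : int) F :
    0 <= eps -> 0 <= dlt -> d <= delta f + dlt + eps + 1 ->
    annuls E (in_ideal_le f (delta f + eps)) ->
    annuls L (in_ideal_le f (delta f + dlt)) ->
  forall i j B, i != j ->
    deg_le (\sum_c (degs d c - 1) + 1 - degs d i - degs d j) B ->
    tensor E L (row_x F 0 i * row_y F 0 j * B) = 0.
Proof.
move=> eps0 dlt0 dle hE hL i j B ij; rewrite sum_degs row_xE row_yE.
elim/deg_le_ind: B / => [|c u B + ih]; first by rewrite mulr0 linear0.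
rewrite mulrDr linearD /= {}ih addr0 -scalerAr linearZ /= tensor_mulX mdeg_xy => hu.
suff : E (extended F i * 'X_[mnm_x u]) = 0 \/ L (extended F j * 'X_[mnm_y u]) = 0.
  by case=> ->; rewrite ?mul0r !mulr0.
case: (split_ordP i) ij hu => {}i ->; case: (split_ordP j) => {}j -> ij;
  rewrite ?extended_l ?extended_r ?degs_l ?degs_r => hu.
- have [le_u|lt_u] := lerP (mdeg (mnm_x u))%:Z (delta f + eps - tdeg (f i)).
    by left; apply/hE/in_ideal_le_mulX.
  by right; apply/hL/in_ideal_le_mulX; lia.
- by left; apply/hE/in_ideal_le_mulX; lia.
- by right; apply/hL/in_ideal_le_mulX; lia.
- by rewrite (ord1 i) (ord1 j) eqxx in ij.
Qed.

(** Exchanging x and y replaces the difference derivatives by other ones and the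
    last row by (f(y), F(y)); neither changes the value of the functional. *)
Lemma fmulC E L (d eps dlt : int) :
    0 <= eps -> 0 <= dlt -> d <= delta f + dlt + eps + 1 ->
    annuls E (in_ideal_le f (delta f + eps)) ->
    annuls L (in_ideal_le f (delta f + dlt)) ->
  eq_in (deg_le d) (fmul f Df nabla E L) (fmul f Df nabla L E).
Proof.
move=> eps0 dlt0 dle hE hL F hF.
have swap_x : map_mx (@swap_xy R n) (row_x F) = row_y F.
  by apply/rowP => c; rewrite [RHS]row_yE -swap_in_x -row_xE mxE.
have swap_y : map_mx (@swap_xy R n) (row_y F) = row_x F.
  by apply/rowP => c; rewrite [RHS]row_xE -swap_in_y -row_yE mxE.
rewrite /fmul !extendE -/(tensor E L _) -/(tensor L E _).
(* From here on only these properties of the two rows and of the derivatives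
   matter. *)
move: (row_x F) (row_y F) (derivs F) swap_x swap_y (derivs_mx hF)
  (tensor_vanish F eps0 dlt0 dle hE hL) => a b A swap_a swap_b hA T0.
pose A' := map_mx (@swap_xy R n) A.
have hA' : derivative_mx (degs d) a b A'.
  split=> [k c|]; first by rewrite mxE; apply/deg_le_swap/hA.1.
  apply: oppr_inj; rewrite opprB -mulNmx -{1}swap_a -{2}swap_b -map_mxB -hA.2.
  rewrite map_mxM; congr (_ *m _).
  by apply/rowP => k; rewrite !mxE rmorphB /= swap_Xvar swap_Yvar opprB.
rewrite (det_derivative_mx T0 hA hA') (det_last_row hA'.2) -swap_a -map_col_mx.
by rewrite det_map_mx /= tensor_swap.
Qed.

(** With last row (f(y), F(y)) it is E that meets the f_i: a monomial of an f_i
    term survives only if its degree in y exceeds what E annuls, and then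
    little of the total degree is left for x. *)
Lemma deg_le_extend E (eps d : int) F :
    annuls E (in_ideal_le f (delta f + eps)) -> deg_le d F ->
  deg_le (Num.max (delta f) (d - eps - 1)) (extend f Df nabla E F).
Proof.
move=> hE hF; have hA := derivs_mx hF.
pose last : 'I_(n + 1) := rshift n ord0.
rewrite extendE (det_last_row hA.2) (expand_det_row _ last) linear_sum /=.
apply: deg_le_sum => c _; rewrite col_mxEd row_yE.
have sum_ne : \sum_(c' | c' != c) (degs d c' - 1) = delta f + d - degs d c.
  have := sum_degs d; rewrite (bigD1 c) // => /(canRL (addKr _)) ->.
  by move: (degs d c); lia.
have : deg_le (delta f + d - degs d c)
    (cofactor (col_mx (derivs F) (row_y F)) last c).
  rewrite -sum_ne; apply: deg_le_cofactor => r c'.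
  by move=> /neq_last[k ->]; rewrite col_mxEu; apply: hA.1.
elim/deg_le_ind: (cofactor _ _ _) / => [|a u B + ih].
  by rewrite mulr0 linear0; apply: deg_le0.
rewrite mulrDr linearD -scalerAr linearZ /= mdeg_xy => hu; apply: deg_leD ih.
apply: deg_leZ; rewrite -[in_y _]mul1r -in_x1.
rewrite apply_y_mulX mul1r.
case: (split_ordP c) hu => i ->; rewrite ?extended_l ?extended_r ?degs_l ?degs_r => hu.
  have [le_u|lt_u] := lerP (mdeg (mnm_y u))%:Z (delta f + eps - tdeg (f i)).
    by rewrite hE ?scale0r; [apply: deg_le0|apply: in_ideal_le_mulX].
  by apply/deg_leZ/deg_leX; rewrite le_max; apply/orP; right; lia.
by apply/deg_leZ/deg_leX; rewrite le_max; apply/orP; left; lia.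
Qed.

(** With last row (f(x), F(x)), every term of the expansion along this row but
    the last is a multiple of some f_i(x), and the last is F(x) det (nabla f).
    For F = 1 the last column is (0, .., 0, 1), so L*1 is the image of
    det (nabla f). *)
Lemma extend_mod L F :
  in_ideal f (extend f Df nabla L F - F * extend f Df nabla L 1).
Proof.
pose last : 'I_(n + 1) := rshift n ord0.
pose M F := col_mx (derivs F) (row_x F).
have ME G k j : M G (lshift 1 k) (lshift 1 j) = Df k j.
  by rewrite /M col_mxEu /derivs row_mxEl.
have cofM G H : cofactor (M G) last last = cofactor (M H) last last.
  apply: (@eq_cofactor _ _ (M G) (M H)) => r c.
  move=> /neq_last[k ->] /neq_last[j ->].
  exact: etrans (ME G k j) (esym (ME H k j)).
have det1 : \det (M 1) = cofactor (M 1) last last.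
  rewrite (expand_det_col _ last) big_split_ord big_ord1 big1 => [|k _] /=.
    rewrite add0r col_mxEd row_xE extended_r -/last.
    by rewrite in_x1 mul1r.
  have nabla1 : nabla k 1 = 0.
    have [/(_ k)/deg_le_lt0 + _] := hnabla 1; rewrite mxE; apply.
    by rewrite /tdeg -mpolyX0 msizeX mdeg0.
  by rewrite col_mxEu row_mxEr mxE nabla1 mul0r.
exists (fun i => apply_y L (cofactor (M F) last (lshift 1 i))).
have -> : extend f Df nabla L 1 = apply_y L (cofactor (M F) last last).
  by rewrite -(cofM 1) -det1.
rewrite extendE.
rewrite (expand_det_row _ last) big_split_ord big_ord1 linearD /=.
rewrite [X in _ + apply_y L (X * _)]col_mxEd row_xE extended_r apply_y_mull addrK.
rewrite linear_sum; apply: eq_bigr => i _ /=.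
by rewrite col_mxEd row_xE extended_l apply_y_mull.
Qed.

End ExtensionOperation.

Theorem theorem5 (R : comNzRingType) (n : nat)
  (f : 'I_n -> {mpoly R[n]}) (hf : forall i, f i != 0)
  (Df : 'M[{mpoly R[n + n]}]_n)
  (hDf : forall i, diff_derivative (f i) (col i Df))
  (nabla : 'I_n -> {linear {mpoly R[n]} -> {mpoly R[n + n]}})
  (hnabla : forall F, diff_derivative F (nabla_col nabla F))
  (eps : int) (heps : 0 <= eps)
  (E' : {scalar {mpoly R[n]}})
  (hE' : annuls E' (in_ideal_le f (delta f + eps)))
  (hE'1 : in_ideal f (extend f Df nabla E' 1 - 1)) :
  (forall (d : int) (F : {mpoly R[n]}), deg_le d F ->
     deg_le (Num.max (delta f) (d - eps - 1)) (extend f Df nabla E' F) /\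
     in_ideal f (F - extend f Df nabla E' F) /\
     deg_le (Num.max (delta f) d) (F - extend f Df nabla E' F)) /\
  (forall l : {scalar {mpoly R[n]}}, annuls l (in_ideal f) ->
     l =1 fmul f Df nabla E' l /\ l =1 fmul f Df nabla l E') /\
  (forall (l L' : {scalar {mpoly R[n]}}) (dlt : int), 0 <= dlt ->
     annuls l (in_ideal f) ->
     eq_in (deg_le (delta f + dlt)) L' l ->
     eq_in (deg_le (delta f + dlt + eps + 1)) l (fmul f Df nabla E' L') /\
     eq_in (deg_le (delta f + dlt + eps + 1)) l (fmul f Df nabla L' E')) /\
  (forall (L : {scalar {mpoly R[n]}}) (dlt : int), 0 <= dlt ->
     annuls L (fun F => in_ideal f F /\ deg_le (delta f + dlt) F) ->
     eq_in (deg_le (delta f + dlt)) L (fmul f Df nabla E' L) /\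
     eq_in (deg_le (delta f + dlt)) L (fmul f Df nabla L E') /\
     eq_in (deg_le (delta f + dlt + eps + 1))
       (fmul f Df nabla E' L) (fmul f Df nabla L E') /\
     annuls (fmul f Df nabla E' L)
       (fun F => in_ideal f F /\ deg_le (delta f + dlt + eps + 1) F) /\
     annuls (fmul f Df nabla L E')
       (fun F => in_ideal f F /\ deg_le (delta f + dlt + eps + 1) F)).
Proof.
set X := extend f Df nabla E'.
have idealX (F : {mpoly R[n]}) : in_ideal f (F - X F).
  have := in_idealN (extend_mod f Df hnabla E' F).
  move/in_idealD => /(_ _ (in_idealN (in_idealMl F hE'1))); rewrite -/X.
  by congr (in_ideal f _); move: (X F) (X 1) => p q; ring.
have degX d F : deg_le d F -> deg_le (Num.max (delta f) (d - eps - 1)) (X F).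
  exact: deg_le_extend.
have degFX d F : deg_le d F -> deg_le (Num.max (delta f) d) (F - X F).
  move=> hF; apply: deg_leB; first by apply: deg_leW hF; rewrite le_max lexx orbT.
  by apply: deg_leW (degX _ _ hF); lia.
have ideal_le_annuls (L : {scalar {mpoly R[n]}}) (dlt : int) :
    annuls L (fun F => in_ideal f F /\ deg_le (delta f + dlt) F) ->
  annuls L (in_ideal_le f (delta f + dlt)).
  by move=> hL F /in_ideal_leW; apply: hL.
(* F - E'*F lies in the ideal, so E'*F and F have the same image under a
   functional that annuls enough of it. *)
have eq_fmul (L : {scalar {mpoly R[n]}}) (F : {mpoly R[n]}) :
    L (F - X F) = 0 -> L F = fmul f Df nabla L E' F.
  by move/eqP; rewrite linearB subr_eq0 => /eqP.
have comm (L : {scalar {mpoly R[n]}}) (dlt : int) : 0 <= dlt ->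
    annuls L (in_ideal_le f (delta f + dlt)) ->
    eq_in (deg_le (delta f + dlt + eps + 1))
      (fmul f Df nabla E' L) (fmul f Df nabla L E').
  by move=> dlt0 hL; apply: fmulC heps dlt0 _ hE' hL.
split; first by move=> d F hF; split; [apply: degX | split; [|apply: degFX]].
split.
  move=> l hl; suff lE F : l F = fmul f Df nabla l E' F.
    (* A functional that annuls the ideal commutes with E' in every degree. *)
    split=> // F; rewrite lE; pose dlt : int := `|tdeg F - delta f|.
    apply/esym/(comm l dlt) => //; first by move=> G /in_ideal_leW[/hl].
    by apply: deg_leW (@deg_le_tdeg_self _ _ F); rewrite /dlt; lia.
  exact/eq_fmul/hl.
split.
  (* E'*F has degree at most delta f + dlt, where L' agrees with l. *)
  move=> l L' dlt dlt0 hl hL'.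
  have L'E : eq_in (deg_le (delta f + dlt + eps + 1)) l (fmul f Df nabla L' E').
    move=> F hF; rewrite (eq_fmul l) ?hl // /fmul hL' //.
    by apply: deg_leW (degX _ _ hF); lia.
  split=> // F hF; rewrite L'E //; apply/esym/(comm L' dlt) => // G.
  move=> /in_ideal_leW[hG dG].
  by rewrite hL' ?hl.
move=> L dlt dlt0 hL.
have LE' : eq_in (deg_le (delta f + dlt)) L (fmul f Df nabla L E').
  move=> F hF; apply/eq_fmul/hL; split=> //.
  by apply: deg_leW (degFX _ _ hF); lia.
have commL := comm L dlt dlt0 (ideal_le_annuls _ _ hL).
have annLE : annuls (fmul f Df nabla L E')
    (fun F => in_ideal f F /\ deg_le (delta f + dlt + eps + 1) F).
  move=> F [iF dF]; apply: hL; split; last by apply: deg_leW (degX _ _ dF); lia.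
  have -> : extend f Df nabla E' F = F - (F - X F) by rewrite subKr.
  by apply/in_idealD/in_idealN.
split; first by move=> F hF; rewrite LE' // commL //; apply: deg_leW hF; lia.
by split=> //; split=> //; split=> // F [iF dF]; rewrite commL // annLE.
Qed.
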